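(* Let $A\in\mathbb{R}^{m\times n}$ with $\|A\|>0$ and $b\in\mathbb{R}^m$ with $\|b\|>0$, and suppose that \[ \min_{x\in\mathbb{R}^n}\frac{\|Ax-b\|}{\|A\|\,\|x\|+\|b\|}>0 . \] Then \[ \min_{x\in\mathbb{R}^n}\frac{\|Ax-b\|^2}{(\|A\|\,\|x\|+\|b\|)^2} =\begin{cases} 1\Big/\inf\limits_{0<\lambda<\lambda_{\min}(A^TA)}\left\{\dfrac{\|A\|^2}{\lambda}+\dfrac{\|b\|^2}{\|b\|^2-b^TA(A^TA-\lambda I)^{-1}A^Tb}\right\}, & \text{if } A^Tb\notin\mathrm{Range}(A^TA-\lambda_{\min}(A^TA)I),\\[3ex] 1\Big/\inf\limits_{0<\lambda\le\lambda_{\min}(A^TA)}\left\{\dfrac{\|A\|^2}{\lambda}+\dfrac{\|b\|^2}{\|b\|^2-b^TA(A^TA-\lambda I)^{+}A^Tb}\right\}, & \text{if } A^Tb\in\mathrm{Range}(A^TA-\lambda_{\min}(A^TA)I), \end{cases} \] and the problem on the right-hand side is a univariate convex optimization problem (in the variable $\lambda$).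
   Context: $\|\cdot\|$ denotes the Euclidean norm for vectors and the spectral norm for matrices. $\lambda_{\min}(M)$ is the smallest eigenvalue of a symmetric matrix $M$, $I$ is the identity matrix, $M^{+}$ is the Moore-Penrose generalized inverse of $M$, and $\mathrm{Range}(M)$ is the range (column space) of $M$. The minimization of $\|Ax-b\|/(\|A\|\|x\|+\|b\|)$ over $x$ is the backward error criterion problem.
   Formalization: Both infima, and the convexity claim, are restricted to those λ in the stated interval where the denominator ‖b‖²−bᵀA(AᵀA−λI)⁻¹Aᵀb (with ⁺ in the second case) is positive; without this the formula fails, e.g. for A=(1,0)ᵀ, b=(1,1)ᵀ. *)

(* Defs.v *)
From HB Require Import structures.
From mathcomp Require Import all_boot all_order all_algebra.
From mathcomp Require Import boolp classical_sets reals convex.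
Set Implicit Arguments.
Unset Strict Implicit.
Unset Printing Implicit Defensive.
Import Order.TTheory GRing.Theory Num.Theory.
Local Open Scope classical_set_scope.
Local Open Scope ring_scope.

(* MathComp-Analysis equips matrices with the max norm, hence the Euclidean
   and spectral norms are introduced here. *)
Definition euclidean_norm (R : realType) (n : nat) (x : 'cV[R]_n) : R :=
  Num.sqrt (\sum_(i < n) x i 0 ^+ 2).

Definition spectral_norm (R : realType) (m n : nat) (A : 'M[R]_(m, n)) : R :=
  sup [set euclidean_norm (A *m x) | x in [set x | euclidean_norm x <= 1]].

(* For symmetric M and n > 0 the set of eigenvalues is finite and nonempty,
   so that the infimum is the smallest eigenvalue. *)
Definition lambda_min (R : realType) (n : nat) (M : 'M[R]_n) : R :=
  inf [set a | eigenvalue M a].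

Definition column_space (R : realType) (m n : nat) (M : 'M[R]_(m, n)) :
  set 'cV[R]_m := range (fun x : 'cV[R]_n => M *m x).

Definition is_mpinv (R : realType) (m n : nat)
    (M : 'M[R]_(m, n)) (P : 'M[R]_(n, m)) : Prop :=
  [/\ M *m P *m M = M, P *m M *m P = P,
      (M *m P)^T = M *m P & (P *m M)^T = P *m M].

(* The only P such that is_mpinv M P, see mpinvP and mpinv_unique. *)
Definition mpinv (R : realType) (m n : nat) (M : 'M[R]_(m, n)) :
  'M[R]_(n, m) := xget 0 [set P | is_mpinv M P].

Lemma mulmx_trmx_unit (R : realType) (r n : nat) (F : 'M[R]_(r, n)) :
  row_free F -> F *m F^T \in unitmx.
Proof.
move=> Ffree; rewrite -row_free_unit -kermx_eq0; apply/eqP/row_matrixP => i.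
rewrite row0; set u := row i _.
have uFF : u *m (F *m F^T) = 0 by apply/sub_kermxP; exact: row_sub.
have {uFF} : (u *m F) *m (u *m F)^T = 0.
  by rewrite trmx_mul !mulmxA -(mulmxA u) uFF mul0mx.
move=> /matrixP/(_ 0 0); rewrite !mxE => /eqP.
rewrite psumr_eq0 => [/allP h|j _]; last by rewrite !mxE -expr2 sqr_ge0.
apply: (row_free_inj Ffree); rewrite mul0mx; apply/rowP => j.
have := h j (mem_index_enum _); rewrite [X in _ * X]mxE -expr2 sqrf_eq0.
by move=> /eqP ->; rewrite mxE.
Qed.

Lemma mpinvP (R : realType) (m n : nat) (M : 'M[R]_(m, n)) :
  is_mpinv M (mpinv M).
Proof.
suff: exists P, is_mpinv M P by move=> /(@xgetPex _ 0 [set P | is_mpinv M P]).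
have [r [C [F [MCF FU CU]]]] : exists r (C : 'M_(m, r)) (F : 'M_(r, n)),
    [/\ M = C *m F, F *m F^T \in unitmx & C^T *m C \in unitmx].
  exists (\rank M), (col_base M), (row_base M); split.
  - by rewrite mulmx_base.
  - exact/mulmx_trmx_unit/row_base_free.
  - have := @mulmx_trmx_unit _ _ _ (col_base M)^T; rewrite trmxK; apply.
    by rewrite /row_free mxrank_tr -/(row_full _) col_base_full.
set G := invmx (F *m F^T); set H := invmx (C^T *m C).
have GT : G^T = G by rewrite /G trmx_inv trmx_mul trmxK.
have HT : H^T = H by rewrite /H trmx_inv trmx_mul trmxK.
have FFG : F *m F^T *m G = 1%:M by exact: mulmxV.
have HCC : H *m C^T *m C = 1%:M by rewrite -mulmxA; exact: mulVmx.
have MP : M *m (F^T *m G *m H *m C^T) = C *m H *m C^T.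
  by rewrite MCF !mulmxA -(mulmxA _ F F^T) -(mulmxA _ (F *m F^T)) FFG mulmx1.
have PM : F^T *m G *m H *m C^T *m M = F^T *m G *m F.
  by rewrite MCF !mulmxA -(mulmxA _ H) -(mulmxA _ (H *m _)) HCC mulmx1.
exists (F^T *m G *m H *m C^T); split.
- by rewrite MP MCF mulmxA -(mulmxA _ H) -(mulmxA _ (H *m _)) HCC mulmx1.
- by rewrite PM !mulmxA -(mulmxA _ F F^T) -(mulmxA _ (F *m F^T)) FFG mulmx1.
- by rewrite MP !trmx_mul trmxK HT mulmxA.
- by rewrite PM !trmx_mul trmxK GT mulmxA.
Qed.

Lemma mpinv_unique (R : realType) (m n : nat)
    (M : 'M[R]_(m, n)) (P : 'M[R]_(n, m)) : is_mpinv M P -> mpinv M = P.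
Proof.
have [h1 h2 h3 h4] := mpinvP M; set Q := mpinv M in h1 h2 h3 h4 *.
case=> k1 k2 k3 k4.
have QM : M *m Q = M *m P.
  by rewrite -h3 -{1}k1 -(mulmxA (M *m P)) trmx_mul h3 k3 mulmxA h1.
have MQ : Q *m M = P *m M.
  by rewrite -h4 -{1}k1 -!mulmxA mulmxA trmx_mul h4 k4 -!mulmxA (mulmxA M Q) h1.
by rewrite -h2 MQ -mulmxA QM mulmxA k2.
Qed.

Definition is_min (R : realType) (T : Type) (f : T -> R) (v : R) : Prop :=
  range f v /\ lbound (range f) v.

(* In the next two definitions ginv is the inverse of A^T A - lambda I in use:
   invmx or mpinv. *)
Definition dual_den (R : realType) (m n : nat) (ginv : 'M[R]_n -> 'M[R]_n)
    (A : 'M[R]_(m, n)) (b : 'cV[R]_m) (lambda : R) : R :=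
  euclidean_norm b ^+ 2
  - (b^T *m A *m ginv (A^T *m A - lambda%:M) *m A^T *m b) 0 0.

Definition dual_obj (R : realType) (m n : nat) (ginv : 'M[R]_n -> 'M[R]_n)
    (A : 'M[R]_(m, n)) (b : 'cV[R]_m) (lambda : R) : R :=
  spectral_norm A ^+ 2 / lambda
  + euclidean_norm b ^+ 2 / dual_den ginv A b lambda.

(* Feasible sets of the univariate problem. The term ||b||^2 / d is understood,
   as usual in convex optimization, as a convex function of d with domain
   d > 0 (value +oo elsewhere), whence the condition on dual_den. It cannot be
   dropped: for A = (1, 0)^T and b = (1, 1)^T, dual_den is 2 - 1 / (1 - lambda),
   which vanishes at 1/2 < lambda_min (A^T A) = 1, and dual_obj is not bounded
   from below on ]1/2, 1[. *)
Definition dual_dom_open (R : realType) (m n : nat)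
    (A : 'M[R]_(m, n)) (b : 'cV[R]_m) : set R :=
  [set lambda | 0 < lambda < lambda_min (A^T *m A)
                /\ 0 < dual_den (@invmx R n) A b lambda].

Definition dual_dom_closed (R : realType) (m n : nat)
    (A : 'M[R]_(m, n)) (b : 'cV[R]_m) : set R :=
  [set lambda | 0 < lambda <= lambda_min (A^T *m A)
                /\ 0 < dual_den (@mpinv R n n) A b lambda].

Definition convex_problem (R : realType) (D : set R) (f : R -> R) : Prop :=
  convex_set (D : set R^o) /\ convex_function (D : set R^o) f.

(* Main.v *)
Require Import Defs.
From HB Require Import structures.
From mathcomp Require Import all_boot all_order all_algebra.
From mathcomp Require Import boolp classical_sets reals convex.
From mathcomp Require Import interval_inference ring lra.
Set Implicit Arguments.
Unset Strict Implicit.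
Unset Printing Implicit Defensive.
Import Order.TTheory GRing.Theory Num.Theory.
Local Open Scope classical_set_scope.
Local Open Scope ring_scope.

(** Let q_t(x) = ||Ax - b||^2 - t ||x||^2. When A^T A - t I is positive
    semidefinite and A^T b lies in its range, dual_den t is the minimum of q_t;
    hence it is a concave function of t, and weak duality is the
    Cauchy-Schwarz inequality
      (a ||x|| + ||b||)^2 <= (a^2 / t + ||b||^2 / d) (t ||x||^2 + d)
    with a = ||A|| and d = dual_den t. Conversely, let x0 attain the minimal
    ratio mu. As a function of ||x||^2, mu^2 (a ||x|| + ||b||)^2 is concave,
    with tangent l ||x||^2 + d at x0, and q_l - d is nonnegative up to a term
    of second order in ||x||^2 - ||x0||^2. Expanding along the lines through
    x0 gives (A^T A - l I) x0 = A^T b and, because every line not tangent to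
    the sphere through x0 meets it a second time, A^T A - l I >= 0. So l is
    dual feasible, and its dual objective is 1 / mu^2. *)

(** * Inner product, Euclidean norm and quadratic forms *)

Definition dot (R : realType) (n : nat) (x y : 'cV[R]_n) : R := (x^T *m y) 0 0.

Definition psd (R : realType) (n : nat) (N : 'M[R]_n) : Prop :=
  forall x : 'cV[R]_n, 0 <= dot x (N *m x).

Section Dot.
Variables (R : realType) (n : nat).
Implicit Types (x y z : 'cV[R]_n) (M N : 'M[R]_n).

Lemma dotE x y : dot x y = \sum_i x i 0 * y i 0.
Proof. by rewrite /dot mxE; apply: eq_bigr => i _; rewrite mxE. Qed.

Lemma dotC x y : dot x y = dot y x.
Proof. by rewrite !dotE; apply: eq_bigr => i _; rewrite mulrC. Qed.

Lemma dotDl x y z : dot (x + y) z = dot x z + dot y z.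
Proof. by rewrite /dot raddfD mulmxDl mxE. Qed.

Lemma dotZl a x y : dot (a *: x) y = a * dot x y.
Proof. by rewrite /dot linearZ -scalemxAl mxE. Qed.

Lemma dotNl x y : dot (- x) y = - dot x y.
Proof. by rewrite -scaleN1r dotZl mulN1r. Qed.

Lemma dotDr x y z : dot z (x + y) = dot z x + dot z y.
Proof. by rewrite !(dotC z) dotDl. Qed.

Lemma dotZr a x y : dot y (a *: x) = a * dot y x.
Proof. by rewrite !(dotC y) dotZl. Qed.

Lemma dotNr x y : dot y (- x) = - dot y x.
Proof. by rewrite !(dotC y) dotNl. Qed.

Lemma dot0r x : dot x 0 = 0.
Proof. by rewrite /dot mulmx0 mxE. Qed.

Lemma dot_ge0 x : 0 <= dot x x.
Proof. by rewrite dotE; apply: sumr_ge0 => i _; rewrite -expr2 sqr_ge0. Qed.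

Lemma dot_eq0 x : (dot x x == 0) = (x == 0).
Proof.
apply/idP/eqP => [|->]; last by rewrite dot0r.
rewrite dotE psumr_eq0 => [/allP h|i _]; last by rewrite -expr2 sqr_ge0.
apply/colP => i; have := h i (mem_index_enum _).
by rewrite -expr2 sqrf_eq0 mxE => /eqP.
Qed.

Lemma dot_gt0 x : x != 0 -> 0 < dot x x.
Proof. by move=> x0; rewrite lt_def dot_eq0 x0 dot_ge0. Qed.

Lemma euclidean_norm_ge0 x : 0 <= euclidean_norm x.
Proof. exact: sqrtr_ge0. Qed.

Lemma sqr_euclidean_norm x : euclidean_norm x ^+ 2 = dot x x.
Proof.
rewrite sqr_sqrtr; last by apply: sumr_ge0 => i _; exact: sqr_ge0.
by rewrite dotE; apply: eq_bigr => i _; rewrite expr2.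
Qed.

Lemma euclidean_normZ s x :
  0 <= s -> euclidean_norm (s *: x) = s * euclidean_norm x.
Proof.
move=> s0; apply: (@pexpIrn _ 2) => //.
- by rewrite nnegrE euclidean_norm_ge0.
- by rewrite nnegrE mulr_ge0 // euclidean_norm_ge0.
- by rewrite exprMn !sqr_euclidean_norm dotZl dotZr mulrA expr2.
Qed.

Lemma euclidean_normN x : euclidean_norm (- x) = euclidean_norm x.
Proof.
by rewrite /euclidean_norm; congr Num.sqrt; apply: eq_bigr => i _; rewrite mxE sqrrN.
Qed.

Lemma dot_shift M t x y :
  dot x ((M - t%:M) *m y) = dot x (M *m y) - t * dot x y.
Proof. by rewrite mulmxBl mul_scalar_mx dotDr dotNr dotZr. Qed.

Lemma dot_sym N x y : N^T = N -> dot x (N *m y) = dot y (N *m x).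
Proof. by move=> NT; rewrite [RHS]dotC /dot trmx_mul NT mulmxA. Qed.

Lemma shift_sym M t : M^T = M -> (M - t%:M)^T = M - t%:M.
Proof. by move=> MT; rewrite raddfB /= MT tr_scalar_mx. Qed.

(** Each [|x i 0 * x j 0|] is at most [dot x x], so the sum of the [|M i j|] is a bound; the added 1
    makes [C] positive. *)
Lemma quadratic_form_bound M :
  exists2 C, 0 < C & forall x, `|dot x (M *m x)| <= C * dot x x.
Proof.
exists (1 + \sum_i \sum_j `|M i j|) => [|x].
  by apply: ltr_wpDr => //; do 2!(apply: sumr_ge0 => ? _).
have sq i : x i 0 ^+ 2 <= dot x x.
  rewrite dotE (bigD1 i) //= -expr2 lerDl; apply: sumr_ge0 => j _.
  by rewrite -expr2 sqr_ge0.
apply: (@le_trans _ _ ((\sum_i \sum_j `|M i j|) * dot x x)); last first.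
  by rewrite ler_wpM2r ?dot_ge0 // lerDr.
rewrite [X in `|X|]dotE mulr_suml (le_trans (ler_norm_sum _ _ _)) //.
apply: ler_sum => i _; rewrite mxE mulr_sumr mulr_suml.
rewrite (le_trans (ler_norm_sum _ _ _)) //; apply: ler_sum => j _.
rewrite mulrCA normrM ler_wpM2l // ler_norml.
by have := sq i; have := sq j; nra.
Qed.

(** * Smallest eigenvalue of a symmetric matrix *)

Lemma not_eigenvalue_unit M t : ~~ eigenvalue M t -> M - t%:M \in unitmx.
Proof. by rewrite negbK -row_free_unit -kermx_eq0. Qed.

(** The eigenvalue is the largest [t] with [M - t%:M] positive semidefinite. Were that shift
    invertible, its form would dominate a positive multiple of [dot x x], and [t] could be
    increased. *)
Lemma exists_min_eigenvalue M : (0 < n)%N -> M^T = M ->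
  exists2 t, eigenvalue M t & psd (M - t%:M).
Proof.
move=> n_gt0 MT; have [C C_gt0 MC] := quadratic_form_bound M.
pose S := [set t | psd (M - t%:M)].
have S0 : S !=set0.
  exists (- C) => x; rewrite dot_shift.
  by have := MC x; rewrite ler_norml => /andP[]; lra.
have [e e_gt0] : exists e : 'cV[R]_n, 0 < dot e e.
  exists (const_mx 1); apply: dot_gt0; apply/eqP => /colP/(_ (Ordinal n_gt0)).
  by rewrite !mxE; apply/eqP/oner_neq0.
have S_le x t : 0 < dot x x -> S t -> t <= dot x (M *m x) / dot x x.
  by move=> x0 /(_ x); rewrite dot_shift ler_pdivlMr // subr_ge0.
have ubS : has_ubound S by exists (dot e (M *m e) / dot e e) => t; exact: S_le.
have St : S (sup S).
  move=> x; rewrite dot_shift subr_ge0.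
  have [->|/dot_gt0 x0] := eqVneq x 0; first by rewrite mulmx0 dot0r mulr0.
  by rewrite -ler_pdivlMr //; apply: ge_sup => // t; exact: S_le.
exists (sup S) => //; apply: contrapT => /negP /not_eigenvalue_unit.
set N := M - _ => Nunit; have [D D_gt0 ND] := quadratic_form_bound (invmx N).
suff SD : S (sup S + D^-1).
  have := ub_le_sup ubS SD; have : 0 < D^-1 by rewrite invr_gt0.
  lra.
(* Positivity of the form N at x - N^-1 x / D gives x.Nx >= x.x / D. *)
move=> x; have NT : N^T = N by exact: shift_sym.
have := St (x - D^-1 *: (invmx N *m x)); rewrite -/N.
have := ND x; rewrite ler_norml => /andP[_].
rewrite mulmxBr -scalemxAr mulKVmx // !(dotDl, dotDr, dotNl, dotNr, dotZl, dotZr).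
rewrite (dotC (invmx N *m x) x) (dot_sym (invmx N *m x)) // mulKVmx //.
rewrite /N !dot_shift mulrDl.
set i := D^-1; have i_gt0 : 0 < i by rewrite invr_gt0.
have : D * i = 1 by rewrite divff ?gt_eqF.
set p := dot x (invmx _ *m x) => Di pD.
have : i * (i * p) <= i * dot x x.
  by rewrite ler_wpM2l ?(ltW i_gt0) // mulrC -ler_pdivlMr // invrK mulrC.
lra.
Qed.

Lemma psd_le_eigenvalue M t a : M^T = M -> psd (M - t%:M) ->
  eigenvalue M a -> t <= a.
Proof.
move=> MT Mt /eigenvalueP [v vM v0].
have Mv : M *m v^T = a *: v^T by rewrite -{1}MT -trmx_mul vM linearZ.
have := Mt v^T; rewrite dot_shift Mv dotZr -mulrBl pmulr_lge0 ?subr_ge0 //.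
by apply: dot_gt0; rewrite -(trmx0 _ 1 n) (inj_eq trmx_inj).
Qed.

Lemma lambda_min_eigenvalue M t : M^T = M -> eigenvalue M t ->
  psd (M - t%:M) -> lambda_min M = t.
Proof.
move=> MT Mt psdMt; apply/eqP; rewrite eq_le; apply/andP; split.
  by apply: ge_inf => //; exists t => a; exact: psd_le_eigenvalue.
by apply: lb_le_inf => [|a]; [exists t | exact: psd_le_eigenvalue].
Qed.

Lemma psd_shiftE M t : (0 < n)%N -> M^T = M ->
  psd (M - t%:M) <-> t <= lambda_min M.
Proof.
move=> n_gt0 MT; have [a Ma psda] := exists_min_eigenvalue n_gt0 MT.
rewrite (lambda_min_eigenvalue MT Ma psda); split => [Mt|ta x].
  exact: psd_le_eigenvalue Mt Ma.
have := psda x; rewrite !dot_shift.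
have := ler_wpM2r (dot_ge0 x) ta; lra.
Qed.

Lemma lt_lambda_min_unit M t : (0 < n)%N -> M^T = M ->
  t < lambda_min M -> M - t%:M \in unitmx.
Proof.
move=> n_gt0 MT; have [a Ma psda] := exists_min_eigenvalue n_gt0 MT.
rewrite (lambda_min_eigenvalue MT Ma psda) => ta.
apply: not_eigenvalue_unit; apply/negP => /(psd_le_eigenvalue MT psda).
by rewrite leNgt ta.
Qed.

End Dot.

(** * Inequalities over the reals *)

Section RealInequalities.
Variable R : realType.
Implicit Types a p q k u w l d : R.

(** This is division by [s] followed by [s] tending to 0 from either side; an explicit small [s] of
    sign opposite to [p] replaces the limit. *)
Lemma linear_coef_eq0 p q k u w :
  (forall s, 0 <= 2 * s * p + s ^+ 2 * q + k * (s * u + s ^+ 2 * w) ^+ 2) ->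
  p = 0.
Proof.
move=> h; apply: contrapT => /eqP p0.
pose D := `|q| + `|k| * (`|u| + `|w|) ^+ 2.
have D0 : 0 <= D by rewrite addr_ge0 // mulr_ge0 // sqr_ge0.
have small s : `|s| <= 1 ->
    s ^+ 2 * q + k * (s * u + s ^+ 2 * w) ^+ 2 <= s ^+ 2 * D.
  move=> s1; have -> : (s * u + s ^+ 2 * w) ^+ 2 = s ^+ 2 * (u + s * w) ^+ 2.
    by ring.
  rewrite mulrCA -mulrDr ler_wpM2l ?sqr_ge0 // lerD ?ler_norm //.
  rewrite (le_trans (ler_norm _)) // normrM ler_wpM2l // normrX.
  rewrite lerXn2r ?nnegrE ?addr_ge0 //.
  by rewrite (le_trans (ler_normD _ _)) // lerD2l normrM ler_piMl.
(* This [c] ensures [|p / c| <= 1] and [2 * c > D]. At [- s], with [s = p / c], the linear term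
   [- 2 * c * s ^ 2] then beats the remainder, at most [D * s ^ 2]. *)
pose c := D + `|p| + 1; have c_gt0 : 0 < c by rewrite ltr_wpDl // addr_ge0.
have cp : c * (p / c) = p by rewrite mulrC divfK ?gt_eqF.
set s := p / c in cp.
have s1 : `|- s| <= 1.
  rewrite normrN normf_div (gtr0_norm c_gt0) ler_pdivrMr // mul1r /c.
  by rewrite addrAC lerDr addr_ge0.
have := h (- s); have := small _ s1.
have : 0 < s ^+ 2.
  rewrite exprn_even_gt0 //= /s mulf_eq0 negb_or p0 invr_eq0.
  by rewrite gt_eqF.
have cE : c = D + `|p| + 1 by []; have P0 := normr_ge0 p.
clearbody c s D => s2.
have -> : 2 * - s * p = - (2 * c * s ^+ 2) by rewrite -[X in _ * X = _]cp; ring.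
rewrite sqrrN => h1 h2.
have : 0 < s ^+ 2 * (2 * c - D) by apply: mulr_gt0 => //; lra.
lra.
Qed.

Lemma constant_coef_ge0 q k u w : 0 < w -> 0 < k ->
  (forall s, s != 0 -> 0 <= q + k * (u + s * w) ^+ 2) -> 0 <= q.
Proof.
move=> w0 k0 h; have [u0|u0] := eqVneq u 0; last first.
  (* The nonzero root of [u + s * w] leaves only [q]. *)
  have s0 : - u / w != 0 by rewrite mulf_eq0 negb_or oppr_eq0 u0 invr_eq0 gt_eqF.
  by have := h _ s0; rewrite divfK ?gt_eqF // subrr expr0n mulr0 addr0.
rewrite leNgt; apply/negP => q0.
pose e := k * w ^+ 2; have e0 : 0 < e by rewrite mulr_gt0 ?exprn_gt0.
have qe : 0 < e - q by lra.
(* Here [0 < s < 1] and [s * e < - q], so [s ^ 2 * e < - q]. *)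
pose s := - q / (e - q); have s0 : 0 < s by rewrite divr_gt0 ?oppr_gt0.
have sE : s * (e - q) = - q by rewrite divfK ?gt_eqF.
have := h s; rewrite gt_eqF // => /(_ isT); rewrite u0 add0r exprMn mulrCA -/e.
nra.
Qed.

(** Cauchy-Schwarz for the vectors [(a / sqrt l, k / sqrt d)] and [(sqrt l * x, sqrt d)]. *)
Lemma ratio_cauchy_schwarz a k l d x : 0 < l -> 0 < d ->
  (a * x + k) ^+ 2 <= (a ^+ 2 / l + k ^+ 2 / d) * (l * x ^+ 2 + d).
Proof.
move=> l0 d0; rewrite -subr_ge0.
have -> : (a ^+ 2 / l + k ^+ 2 / d) * (l * x ^+ 2 + d) - (a * x + k) ^+ 2
    = (a * d - k * l * x) ^+ 2 / (l * d) by field; rewrite !gt_eqF.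
by rewrite divr_ge0 ?sqr_ge0 // mulr_ge0 ?ltW.
Qed.

Lemma conv_gt0 p u w : 0 <= p <= 1 -> 0 < u -> 0 < w -> 0 < p * u + (1 - p) * w.
Proof. by case/andP => p0 p1 u0 w0; nra. Qed.

Lemma inv_convex p u w : 0 <= p <= 1 -> 0 < u -> 0 < w ->
  (p * u + (1 - p) * w)^-1 <= p / u + (1 - p) / w.
Proof.
move=> p01 u0 w0; have D := conv_gt0 p01 u0 w0; case/andP: p01 => p0 p1.
rewrite -subr_ge0.
have -> : p / u + (1 - p) / w - (p * u + (1 - p) * w)^-1
    = p * (1 - p) * (u - w) ^+ 2 / (u * w * (p * u + (1 - p) * w)).
  by field; rewrite !gt_eqF.
apply: divr_ge0; last by rewrite ltW // !mulr_gt0.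
by apply: mulr_ge0 (sqr_ge0 _); rewrite mulr_ge0 ?subr_ge0.
Qed.

End RealInequalities.

(** * The Lagrangian [q_t] and its dual function *)

Section Lagrangian.
Variables (R : realType) (m n : nat) (A : 'M[R]_(m, n)) (b : 'cV[R]_m).
Local Notation M := (A^T *m A).
Local Notation c := (A^T *m b).
Local Notation nrm := euclidean_norm.

Lemma gram_sym : M^T = M.
Proof. by rewrite trmx_mul trmxK. Qed.

Lemma sqr_residual x :
  nrm (A *m x - b) ^+ 2 = dot x (M *m x) - 2 * dot c x + nrm b ^+ 2.
Proof.
have dotA y : dot (A *m x) y = dot x (A^T *m y).
  by rewrite /dot trmx_mul mulmxA.
rewrite !sqr_euclidean_norm !(dotDl, dotDr, dotNl, dotNr) (dotC b (A *m x)).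
by rewrite !dotA mulmxA (dotC c); ring.
Qed.

(** Completes the square at a stationary point [y] of [q_t]. Any solution [y] will do, so singular
    shifts are covered. *)
Lemma lagrangianE t x y : (M - t%:M) *m y = c ->
  nrm (A *m x - b) ^+ 2 - t * nrm x ^+ 2
  = dot (x - y) ((M - t%:M) *m (x - y)) + (nrm b ^+ 2 - dot c y).
Proof.
move=> Ny; rewrite sqr_residual (sqr_euclidean_norm x) mulmxBr Ny.
rewrite !(dotDl, dotNl, dotDr, dotNr) (dot_sym y) ?shift_sym ?gram_sym // Ny.
by rewrite dot_shift (dotC c x) (dotC c y); ring.
Qed.

Lemma lagrangian_ge t x y : psd (M - t%:M) -> (M - t%:M) *m y = c ->
  nrm b ^+ 2 - dot c y <= nrm (A *m x - b) ^+ 2 - t * nrm x ^+ 2.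
Proof. by move=> Nge0 /lagrangianE ->; rewrite lerDr. Qed.

Lemma lagrangian_eq t y : (M - t%:M) *m y = c ->
  nrm (A *m y - b) ^+ 2 - t * nrm y ^+ 2 = nrm b ^+ 2 - dot c y.
Proof. by move/lagrangianE ->; rewrite subrr mulmx0 dot0r add0r. Qed.

Lemma dual_denE ginv t :
  dual_den ginv A b t = nrm b ^+ 2 - dot c (ginv (M - t%:M) *m c).
Proof. by rewrite /dual_den /dot trmx_mul trmxK !mulmxA. Qed.

(** * Optimality conditions at a minimizer [x0] *)

Section Minimizer.
Variables (a mu : R) (x0 : 'cV[R]_n).
Hypotheses (n_gt0 : (0 < n)%N) (a_gt0 : 0 < a) (b_gt0 : 0 < nrm b).
Hypothesis mu_gt0 : 0 < mu.
Hypothesis mu_le : forall x,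
  mu ^+ 2 * (a * nrm x + nrm b) ^+ 2 <= nrm (A *m x - b) ^+ 2.
Hypothesis mu_x0 :
  mu ^+ 2 * (a * nrm x0 + nrm b) ^+ 2 = nrm (A *m x0 - b) ^+ 2.

(** The multiplier [l] divides by this norm. At [x0 = 0] the minimal ratio would be 1, but moving
    away from 0 the squared denominator grows linearly, the averaged squared residual only
    quadratically. *)
Lemma minimizer_norm_gt0 : 0 < nrm x0.
Proof.
rewrite lt_def euclidean_norm_ge0 andbT; apply/negP => /eqP x00.
have x0E : x0 = 0 by apply/eqP; rewrite -dot_eq0 -sqr_euclidean_norm x00 expr0n.
have mu1 : mu ^+ 2 = 1.
  have := mu_x0; rewrite x00 sqr_residual x0E mulmx0 !dot0r mulr0 !add0r.
  rewrite mulr0 oppr0 add0r => h; apply: (@mulIf _ (nrm b ^+ 2)).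
    by rewrite sqrf_eq0 gt_eqF.
  by rewrite h mul1r.
have [e e_gt0] : exists e : 'cV[R]_n, 0 < nrm e.
  exists (const_mx 1); rewrite lt_def euclidean_norm_ge0 andbT -sqrf_eq0.
  rewrite sqr_euclidean_norm dot_eq0.
  apply/eqP => /colP/(_ (Ordinal n_gt0)); rewrite !mxE; exact/eqP/oner_neq0.
(* Averaging the bound at s e and - s e removes the linear term of the residual. *)
have key s : 0 < s -> 2 * a * nrm b * nrm e <= s * dot e (M *m e).
  move=> s0; have := mu_le (s *: e); have := mu_le (s *: - e).
  rewrite mu1 !mul1r !sqr_residual !euclidean_normZ ?(ltW s0) // euclidean_normN.
  rewrite -!scalemxAr mulmxN !(dotZl, dotZr, dotNl, dotNr) => h1 h2.
  rewrite -(ler_pM2l s0).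
  have : 0 <= (s * a * nrm e) ^+ 2 by exact: sqr_ge0.
  lra.
pose Q := `|dot e (M *m e)|; have Q0 : 0 <= Q := normr_ge0 _.
have w_gt0 : 0 < a * nrm b * nrm e by rewrite !mulr_gt0.
have Q1 : 0 < Q + 1 by lra.
(* This [s] gives [s * Q <= a * nrm b * nrm e], half of what [key] demands; the 1 added to [Q]
   covers [Q = 0]. *)
have s0 : 0 < a * nrm b * nrm e / (Q + 1) by rewrite divr_gt0.
have := key _ s0; have := ler_norm (dot e (M *m e)); rewrite -/Q.
have : a * nrm b * nrm e / (Q + 1) * (Q + 1) = a * nrm b * nrm e.
  by rewrite divfK ?gt_eqF.
move: (_ / _) s0 => s s0 sE qQ h.
have : s * dot e (M *m e) <= s * Q by rewrite ler_wpM2l // ltW.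
lra.
Qed.

Let t0 := nrm x0.
(** Slope and intercept of the tangent: in [mu ^ 2 * (a * sqrt r + nrm b) ^ 2], the term
    [2 * sqrt r] is replaced by its tangent [r / t0 + t0] at [r = t0 ^ 2]. *)
Let l := mu ^+ 2 * (a ^+ 2 + a * nrm b / t0).
Let d := mu ^+ 2 * (nrm b ^+ 2 + a * nrm b * t0).
(* The tangent exceeds mu^2 (a t + ||b||)^2 by mu^2 (a ||b|| / t0) (t - t0)^2, and
   (t - t0)^2 <= (t^2 - t0^2)^2 / t0^2. *)
Let k := mu ^+ 2 * (a * nrm b / t0) / t0 ^+ 2.

Lemma multiplier_gt0 : 0 < l.
Proof.
have t0_gt0 : 0 < t0 := minimizer_norm_gt0.
by rewrite mulr_gt0 ?addr_gt0 ?divr_gt0 ?mulr_gt0 ?exprn_gt0.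
Qed.

Lemma tangent_bound x :
  0 <= nrm (A *m x - b) ^+ 2 - l * nrm x ^+ 2 - d
       + k * (nrm x ^+ 2 - t0 ^+ 2) ^+ 2.
Proof.
have t0_gt0 : 0 < t0 := minimizer_norm_gt0.
have := mu_le x; move: (nrm (A *m x - b) ^+ 2) => r.
have := euclidean_norm_ge0 x; move: (nrm x) => t t_ge0 rt.
have gap : mu ^+ 2 * (a * t + nrm b) ^+ 2 - l * t ^+ 2 - d
    + k * (t ^+ 2 - t0 ^+ 2) ^+ 2
  = mu ^+ 2 * a * nrm b * (t - t0) ^+ 2 * t * (t + 2 * t0) / t0 ^+ 3.
  by rewrite /l /d /k; field; rewrite gt_eqF.
have : 0 <= mu ^+ 2 * a * nrm b * (t - t0) ^+ 2 * t * (t + 2 * t0) / t0 ^+ 3.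
  apply: divr_ge0; last by rewrite exprn_ge0 // ltW.
  apply: mulr_ge0; last by rewrite addr_ge0 // mulr_ge0 // ltW.
  apply: mulr_ge0 => //; apply: mulr_ge0 (sqr_ge0 _).
  by rewrite ltW // !mulr_gt0 // exprn_gt0.
lra.
Qed.

Lemma tangent_eq : nrm (A *m x0 - b) ^+ 2 - l * nrm x0 ^+ 2 = d.
Proof.
rewrite -mu_x0 /l /d /t0; field.
by rewrite gt_eqF // minimizer_norm_gt0.
Qed.

Lemma minimizer_expansion x s v :
  nrm (A *m (x + s *: v) - b) ^+ 2 - l * nrm (x + s *: v) ^+ 2
  = nrm (A *m x - b) ^+ 2 - l * nrm x ^+ 2
    + 2 * s * dot v ((M - l%:M) *m x - c) + s ^+ 2 * dot v ((M - l%:M) *m v).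
Proof.
rewrite !sqr_residual !(sqr_euclidean_norm (_ + _)) (sqr_euclidean_norm x).
rewrite [dot v (_ - c)]dotDr dotNr mulmxDr -scalemxAr !dot_shift.
rewrite !(dotDl, dotDr, dotZl, dotZr) (dot_sym x v) ?gram_sym //.
by rewrite (dotC v c) (dotC x v); ring.
Qed.

(** [tangent_bound] on the line through [x0] along [v], with [tangent_eq] substituted. The linear
    term in [s] yields stationarity; the nonzero [s] that cancels the last square, if there is one,
    is the second intersection with the sphere and yields semidefiniteness. *)
Lemma minimizer_perturbation s v :
  0 <= 2 * s * dot v ((M - l%:M) *m x0 - c) + s ^+ 2 * dot v ((M - l%:M) *m v)
       + k * (s * (2 * dot x0 v) + s ^+ 2 * dot v v) ^+ 2.
Proof.
have := tangent_bound (x0 + s *: v); rewrite minimizer_expansion tangent_eq.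
have -> : nrm (x0 + s *: v) ^+ 2 - t0 ^+ 2
    = s * (2 * dot x0 v) + s ^+ 2 * dot v v.
  rewrite /t0 !sqr_euclidean_norm !(dotDl, dotDr, dotZl, dotZr) (dotC v x0).
  by ring.
by congr (0 <= _); ring.
Qed.

Lemma minimizer_stationary : (M - l%:M) *m x0 = c.
Proof.
apply/eqP; rewrite -subr_eq0 -dot_eq0; apply/eqP.
(* With [v] equal to the defect of the stationarity equation, the linear coefficient is its squared
   norm. *)
exact: linear_coef_eq0 (fun s => minimizer_perturbation s _).
Qed.

Lemma multiplier_psd : psd (M - l%:M).
Proof.
move=> v; have [->|v0] := eqVneq v 0; first by rewrite mulmx0 dot0r.
apply: (@constant_coef_ge0 _ _ k (2 * dot x0 v) (dot v v)); first exact: dot_gt0.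
  have t0_gt0 : 0 < t0 := minimizer_norm_gt0.
  by rewrite divr_gt0 ?exprn_gt0 // mulr_gt0 ?exprn_gt0 // divr_gt0 // mulr_gt0.
move=> s s0; have := minimizer_perturbation s v.
rewrite minimizer_stationary subrr dot0r mulr0 add0r.
have -> : s * (2 * dot x0 v) + s ^+ 2 * dot v v
    = s * (2 * dot x0 v + s * dot v v).
  by ring.
rewrite exprMn mulrCA -mulrDr pmulr_rge0 //.
by rewrite exprn_even_gt0.
Qed.

Lemma minimizer_multiplier : exists l y,
  [/\ 0 < l, psd (M - l%:M), (M - l%:M) *m y = c, 0 < nrm b ^+ 2 - dot c y
    & a ^+ 2 / l + nrm b ^+ 2 / (nrm b ^+ 2 - dot c y) = (mu ^+ 2)^-1].
Proof.
have t0_gt0 : 0 < t0 := minimizer_norm_gt0.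
exists l, x0; rewrite -(lagrangian_eq minimizer_stationary) tangent_eq.
split; [exact: multiplier_gt0|exact: multiplier_psd|exact: minimizer_stationary| |].
  by rewrite mulr_gt0 ?exprn_gt0 // addr_gt0 ?exprn_gt0 // !mulr_gt0.
have at_gt0 : 0 < a * t0 + nrm b by rewrite addr_gt0 // mulr_gt0.
(* With [g = a * t0 + nrm b], the factored forms make the quotients [a * t0 / (mu ^ 2 * g)] and
   [nrm b / (mu ^ 2 * g)]. *)
have -> : l = mu ^+ 2 * a * (a * t0 + nrm b) / t0.
  by rewrite /l; field; rewrite gt_eqF.
have -> : d = mu ^+ 2 * nrm b * (a * t0 + nrm b) by rewrite /d; ring.
by field; rewrite !gt_eqF.
Qed.

End Minimizer.

(** * Strong duality and convexity *)

(** Common to both cases of the theorem. The hypotheses on [S] make [dual_den] the minimum of [q_t]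
    for [t] in [S], make [S] convex, and put the multiplier found at the minimizer into [S]. *)
Lemma dual_problem (ginv : 'M[R]_n -> 'M[R]_n) (S : set R) mu :
  (0 < n)%N -> 0 < spectral_norm A -> 0 < nrm b -> 0 < mu ->
  is_min (fun x => nrm (A *m x - b) / (spectral_norm A * nrm x + nrm b)) mu ->
  (forall t, S t -> [/\ 0 < t, psd (M - t%:M)
     & (M - t%:M) *m (ginv (M - t%:M) *m c) = c]) ->
  (forall p t u, 0 <= p <= 1 -> S t -> S u -> S (p * t + (1 - p) * u)) ->
  (forall t y, 0 < t -> psd (M - t%:M) -> (M - t%:M) *m y = c -> S t) ->
  let D := [set t | S t /\ 0 < dual_den ginv A b t] in
  is_min (fun x => nrm (A *m x - b) ^+ 2 / (spectral_norm A * nrm x + nrm b) ^+ 2)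
    (1 / inf [set dual_obj ginv A b t | t in D])
  /\ convex_problem D (dual_obj ginv A b).
Proof.
move=> n_gt0 A_gt0 b_gt0 mu_gt0 [[x0 _ mu_x0] mu_lb] S_psd S_conv S_all D.
set a := spectral_norm A in A_gt0 mu_x0 mu_lb *.
have den_gt0 (x : 'cV_n) : 0 < a * nrm x + nrm b.
  by rewrite ltr_wpDl // mulr_ge0 ?euclidean_norm_ge0 // ltW.
have mu_le x : mu ^+ 2 * (a * nrm x + nrm b) ^+ 2 <= nrm (A *m x - b) ^+ 2.
  rewrite -exprMn lerXn2r ?nnegrE ?euclidean_norm_ge0 //.
    by rewrite mulr_ge0 // ltW.
  by rewrite -ler_pdivlMr //; apply: mu_lb; exists x.
have mu_eq : mu ^+ 2 * (a * nrm x0 + nrm b) ^+ 2 = nrm (A *m x0 - b) ^+ 2.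
  by rewrite -exprMn -mu_x0 divfK ?gt_eqF.
have [l [y [l_gt0 Nl yl d_gt0 lE]]] :=
  minimizer_multiplier n_gt0 A_gt0 b_gt0 mu_gt0 mu_le mu_eq.
have Sl := S_all l y l_gt0 Nl yl.
(* The value is the same for every solution [z], so [y] may stand in for the solution built from
   [ginv], even at a singular shift. *)
have den_eq t z : (M - t%:M) *m z = c -> S t ->
    nrm b ^+ 2 - dot c z = dual_den ginv A b t.
  move=> Nz /S_psd[_ Nt]; rewrite dual_denE; set w := _ *m c => Nw.
  by rewrite -{1}Nw -{1}Nz (dotC (_ *m w)) dot_sym ?shift_sym ?gram_sym //
    (dotC w).
have Dl : D l by split => //; rewrite -(den_eq _ _ yl).
have obj_l : dual_obj ginv A b l = (mu ^+ 2)^-1.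
  by rewrite /dual_obj -(den_eq _ _ yl).
have lag t x : S t ->
    dual_den ginv A b t <= nrm (A *m x - b) ^+ 2 - t * nrm x ^+ 2.
  by move=> /S_psd[_ Nt Nw]; rewrite dual_denE; exact: lagrangian_ge.
have lag_eq t : S t -> exists x,
    dual_den ginv A b t = nrm (A *m x - b) ^+ 2 - t * nrm x ^+ 2.
  move=> /S_psd[_ _ Nw]; exists (ginv (M - t%:M) *m c).
  by rewrite dual_denE lagrangian_eq.
have mu2_gt0 : 0 < mu ^+ 2 by rewrite exprn_gt0.
have lb : lbound [set dual_obj ginv A b t | t in D] (mu ^+ 2)^-1.
  move=> _ [t [St dt] <-]; have [t_gt0 _ _] := S_psd _ St.
  rewrite -div1r ler_pdivrMr //.
  have := ratio_cauchy_schwarz a (nrm b) (nrm x0) t_gt0 dt.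
  rewrite -/(dual_obj ginv A b t) => cs.
  have obj_ge0 : 0 <= dual_obj ginv A b t.
    by rewrite addr_ge0 ?divr_ge0 ?sqr_ge0 // ltW.
  have := lag t x0 St; have := den_gt0 x0; rewrite -mu_eq.
  move: (a * nrm x0 + _) cs => g cs g_gt0 h.
  have g2 : 0 < g ^+ 2 by rewrite exprn_gt0.
  rewrite -(ler_pM2r g2) mul1r (le_trans cs) // -mulrA ler_wpM2l //; lra.
have inf_eq : inf [set dual_obj ginv A b t | t in D] = (mu ^+ 2)^-1.
  apply/eqP; rewrite eq_le; apply/andP; split.
    by apply: ge_inf; [exists (mu ^+ 2)^-1 | exists l].
  by apply: lb_le_inf => //; exists (dual_obj ginv A b l), l.
(* [dual_den] is a minimum of functions affine in [t]; the minimizer for the intermediate parameter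
   is tested at both ends. *)
have conc p t u : 0 <= p <= 1 -> D t -> D u ->
    p * dual_den ginv A b t + (1 - p) * dual_den ginv A b u
    <= dual_den ginv A b (p * t + (1 - p) * u).
  move=> p01 [St _] [Su _]; have [x ->] := lag_eq _ (S_conv _ _ _ p01 St Su).
  move/andP: p01 => [p0 p1]; have q0 : 0 <= 1 - p by lra.
  have := ler_wpM2l p0 (lag t x St); have := ler_wpM2l q0 (lag u x Su); lra.
have D_conv p t u : 0 <= p <= 1 -> D t -> D u -> D (p * t + (1 - p) * u).
  move=> p01 Dt Du; split; first by apply: S_conv => //; [case: Dt | case: Du].
  apply: lt_le_trans (conc _ _ _ p01 Dt Du).
  by apply: conv_gt0 => //; [case: Dt | case: Du].
split; [rewrite inf_eq div1r invrK; split|split].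
- by exists x0 => //; rewrite -mu_eq mulfK // sqrf_eq0 gt_eqF.
- by move=> _ [x _ <-]; rewrite ler_pdivlMr ?exprn_gt0.
- move=> t u p; rewrite !inE => Dt Du; apply: (D_conv p%:num) => //.
  by rewrite ge0 le1.
move=> p t u; rewrite !inE => Dt Du.
have p01 : 0 <= p%:num <= 1 by rewrite ge0 le1.
have [[St dt] [Su du]] := (Dt, Du).
have [t_gt0 _ _] := S_psd _ St; have [u_gt0 _ _] := S_psd _ Su.
change (dual_obj ginv A b (p%:num * t + (1 - p%:num) * u)
  <= p%:num * dual_obj ginv A b t + (1 - p%:num) * dual_obj ginv A b u).
move: p%:num p01 => {}p p01.
have h1 := ler_wpM2l (sqr_ge0 a) (inv_convex p01 t_gt0 u_gt0).
(* The reciprocal is decreasing and convex, and [dual_den] is concave and positive on [D]. *)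
have h2 : (dual_den ginv A b (p * t + (1 - p) * u))^-1
    <= p / dual_den ginv A b t + (1 - p) / dual_den ginv A b u.
  apply: le_trans (inv_convex p01 dt du); rewrite lef_pV2 ?posrE ?conc //.
    by case: (D_conv _ _ _ p01 Dt Du).
  exact: conv_gt0.
have {}h2 := ler_wpM2l (sqr_ge0 (nrm b)) h2.
rewrite /dual_obj -/a; lra.
Qed.

End Lagrangian.

Lemma spectral_norm_gt0_cols (R : realType) (m n : nat) (A : 'M[R]_(m, n)) :
  0 < spectral_norm A -> (0 < n)%N.
Proof.
case: n A => // A; rewrite /spectral_norm => A_gt0.
suff : [set euclidean_norm (A *m x) | x in [set x | euclidean_norm x <= 1]]
    = [set 0].
  by move=> h; move: A_gt0; rewrite h sup1 ltxx.
have A0 x : euclidean_norm (A *m x) = 0.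
  apply/eqP; rewrite -sqrf_eq0 sqr_euclidean_norm dot_eq0.
  by apply/eqP/colP => i; rewrite !mxE big_ord0.
apply/seteqP; split => [_ [x _ <-] /=|_ ->]; first by rewrite A0.
by exists 0 => /=; rewrite ?A0 // /euclidean_norm big_ord0 sqrtr0.
Qed.

Theorem mainTheorem3 (R : realType) (m n : nat)
    (A : 'M[R]_(m, n)) (b : 'cV[R]_m)
    (A_gt0 : 0 < spectral_norm A) (b_gt0 : 0 < euclidean_norm b)
    (mu : R)
    (mu_min : is_min (fun x : 'cV[R]_n =>
        euclidean_norm (A *m x - b)
        / (spectral_norm A * euclidean_norm x + euclidean_norm b)) mu)
    (mu_gt0 : 0 < mu) :
  (~ column_space (A^T *m A - (lambda_min (A^T *m A))%:M) (A^T *m b) ->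
    is_min (fun x : 'cV[R]_n =>
        euclidean_norm (A *m x - b) ^+ 2
        / (spectral_norm A * euclidean_norm x + euclidean_norm b) ^+ 2)
      (1 / inf [set dual_obj (@invmx R n) A b lambda
               | lambda in dual_dom_open A b])
    /\ convex_problem (dual_dom_open A b) (dual_obj (@invmx R n) A b))
  /\
  (column_space (A^T *m A - (lambda_min (A^T *m A))%:M) (A^T *m b) ->
    is_min (fun x : 'cV[R]_n =>
        euclidean_norm (A *m x - b) ^+ 2
        / (spectral_norm A * euclidean_norm x + euclidean_norm b) ^+ 2)
      (1 / inf [set dual_obj (@mpinv R n n) A b lambda
               | lambda in dual_dom_closed A b])
    /\ convex_problem (dual_dom_closed A b) (dual_obj (@mpinv R n n) A b)).
Proof.
have n_gt0 := spectral_norm_gt0_cols A_gt0; have MT := gram_sym A.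
split=> [notR|inR]; apply: (dual_problem _ _ _ _ mu_min) => //.
- move=> t /andP[t_gt0 tl]; split => //.
    by apply/(psd_shiftE _ n_gt0 MT); exact: ltW.
  by rewrite mulKVmx // lt_lambda_min_unit.
- move=> p t u p01 /andP[t0 tl] /andP[u0 ul]; rewrite conv_gt0 //=.
  have := conv_gt0 p01 (etrans (subr_gt0 _ _) tl) (etrans (subr_gt0 _ _) ul).
  lra.
- move=> t y t0 /(psd_shiftE _ n_gt0 MT) tl Ny; rewrite t0 /= lt_neqAle tl andbT.
  (* At [t = lambda_min] the solution [y] would put [A^T *m b] in the excluded range. *)
  by apply/eqP => tE; apply: notR; exists y => //; rewrite -tE.
- move=> t /andP[t_gt0 tl]; split => //; first exact/(psd_shiftE _ n_gt0 MT).
  (* Below [lambda_min] the shift is invertible; at [lambda_min] solvability is the range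
     hypothesis. *)
  have [x Nx] : exists x, (A^T *m A - t%:M) *m x = A^T *m b.
    move: tl; rewrite le_eqVlt => /predU1P[->|tl].
      by case: inR => x _ ?; exists x.
    exists (invmx (A^T *m A - t%:M) *m (A^T *m b)).
    by rewrite mulKVmx // lt_lambda_min_unit.
  (* The first Penrose identity turns any solution [x] into the one given by [mpinv]. *)
  by rewrite -Nx !mulmxA; have [-> _ _ _] := mpinvP (A^T *m A - t%:M).
- move=> p t u p01 /andP[t0 tl] /andP[u0 ul]; rewrite conv_gt0 //=.
  by case/andP: p01 => p0 p1; nra.
- by move=> t y t0 /(psd_shiftE _ n_gt0 MT) tl _; rewrite t0.
Qed.
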